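(* Let $\lambda\neq0$, $q=1-\lambda$, and let $\mathcal{M}=\{p_\vartheta(x)=\exp_q(\vartheta\cdot F(x))e^{-\varphi_\lambda(\vartheta)}:\vartheta\in\Omega\}$ be a $\lambda$-exponential family satisfying the support condition, with common support $\mathcal{X}_0$. On $\mathcal{X}_0$, with the same $F$ and with $\nu$ restricted to $\mathcal{X}_0$, let $\mathcal{N}=\{p_\theta(x)=\exp_q(\theta\cdot F(x)-\phi_q(\theta)):\theta\in\Theta\}$ be the $q$-exponential family, where $\Theta$ is the natural (maximal) parameter set. For $\vartheta\in\Omega$ let $\theta=\vartheta e^{-\lambda\varphi_\lambda(\vartheta)}$. Then $\theta\in\Theta$ and $p_\vartheta(\cdot)=p_\theta(\cdot)$ on $\mathcal{X}_0$ (so $\mathcal{M}$ may be considered as a subset of $\mathcal{N}$). If, in addition, $F_1,\dots,F_d$ are linearly independent with respect to $\nu$ on $\mathcal{X}_0$, then the mapping $\Omega\to\Theta$, $\vartheta\mapsto\theta=\vartheta e^{-\lambda\varphi_\lambda(\vartheta)}$, is one-to-one.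
   Context: Notation: $t_+=\max\{t,0\}$, and $0^{s}=\infty$ for $s<0$. The $q$-exponential function is $\exp_q(t)=[1+(1-q)t]_+^{1/(1-q)}=[1+\lambda t]_+^{1/\lambda}\in[0,\infty]$. $\lambda$-exponential family: let $\nu$ be a measure on a measurable space $\mathcal{X}$ and $F=(F_1,\dots,F_d):\mathcal{X}\to\mathbb{R}^d$ measurable. Put $\varphi_\lambda(\vartheta)=\log\int \exp_q(\vartheta\cdot F(x))\,d\nu(x)$ and $\Omega=\{\vartheta\in\mathbb{R}^d:\varphi_\lambda(\vartheta)<\infty\}$; each $p_\vartheta(x)=\exp_q(\vartheta\cdot F(x))e^{-\varphi_\lambda(\vartheta)}$, $\vartheta\in\Omega$, is a probability density with respect to $\nu$ (so $\varphi_\lambda$ is finite on $\Omega$). The support condition says that the set $\{x:p_\vartheta(x)>0\}$ is the same set $\mathcal{X}_0$ for all $\vartheta\in\Omega$. $q$-exponential family on $\mathcal{X}_0$: $\Theta$ is the set of all $\theta\in\mathbb{R}^d$ for which there is a (necessarily unique) real number $\phi_q(\theta)$ with $\int_{\mathcal{X}_0}\exp_q(\theta\cdot F(x)-\phi_q(\theta))\,d\nu(x)=1$. Linear independence with respect to $\nu$ on $\mathcal{X}_0$ means that no nontrivial linear combination of $F_1,\dots,F_d$ vanishes $\nu$-a.e. on $\mathcal{X}_0$. *)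

(* Defs.v *)
From HB Require Import structures.
From mathcomp Require Export all_boot all_order all_algebra.
From mathcomp Require Export all_classical all_reals all_analysis.
Export Order.TTheory GRing.Theory Num.Theory.
Export numFieldNormedType.Exports.

Set Implicit Arguments.
Unset Strict Implicit.
Unset Printing Implicit Defensive.

Local Open Scope classical_set_scope.
Local Open Scope ring_scope.

(* Real powers of a >= 0 with values in [0, +oo] and 0 ^ s = +oo for s < 0
   (the library's powR has 0 `^ s = 0 there). *)
Definition epow {R : realType} (a s : R) : \bar R :=
  if (a == 0) && (s < 0) then +oo%E else (a `^ s)%:E.

(* exp_q(t) = [1 + (1 - q) t]_+ ^ (1 / (1 - q)); only meaningful for q != 1. *)
Definition expq {R : realType} (q t : R) : \bar R :=
  epow (Num.max (1 + (1 - q) * t) 0) (1 - q)^-1.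

Definition dotp {R : realType} {d : nat} (u v : 'rV[R]_d) : R :=
  \sum_(i < d) u ord0 i * v ord0 i.

Section Families.
Context {R : realType} {disp : measure_display} {X : measurableType disp}
  {d : nat}.
Variables (nu : {measure set X -> \bar R}) (F : X -> 'rV[R]_d).

(* Borel measurability into R^d, stated coordinatewise. *)
Definition measurable_vec : Prop :=
  forall i : 'I_d, measurable_fun [set: X] (fun x => F x ord0 i).

Section LambdaFamily.
Variable lam : R.

(* Extended real, with log 0 = -oo and log +oo = +oo. *)
Definition lam_phi (vt : 'rV[R]_d) : \bar R :=
  lne (\int[nu]_x expq (1 - lam) (dotp vt (F x)))%E.

Definition lam_Omega : set 'rV[R]_d := [set vt | (lam_phi vt < +oo)%E].

Definition lam_density (vt : 'rV[R]_d) (x : X) : \bar R :=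
  (expq (1 - lam) (dotp vt (F x)) * expeR (- lam_phi vt))%E.

(* Having integral 1 excludes lam_phi vt = -oo, so that lam_phi is
   finite on lam_Omega. *)
Definition lam_exponential_family : Prop :=
  measurable_vec /\
  forall vt, lam_Omega vt -> (\int[nu]_x lam_density vt x = 1)%E.

Definition support_condition (X0 : set X) : Prop :=
  forall vt, lam_Omega vt -> [set x | (0 < lam_density vt x)%E] = X0.

(* vt * exp(- lam * phi_lam(vt)); used on lam_Omega, where lam_phi is finite. *)
Definition lam_to_q (vt : 'rV[R]_d) : 'rV[R]_d :=
  expR (- lam * fine (lam_phi vt)) *: vt.

End LambdaFamily.

Section QFamily.
Variables (X0 : set X) (q : R).

Definition q_normalizer (th : 'rV[R]_d) : set R :=
  [set c | (\int[nu]_(x in X0) expq q (dotp th (F x) - c) = 1)%E].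

Definition q_Theta : set 'rV[R]_d := [set th | q_normalizer th !=set0].

(* Some element of q_normalizer th if th is in q_Theta, and 0 otherwise. *)
Definition q_phi (th : 'rV[R]_d) : R := xget 0 (q_normalizer th).

Definition q_density (th : 'rV[R]_d) (x : X) : \bar R :=
  expq q (dotp th (F x) - q_phi th).

End QFamily.

Definition ae_linearly_independent (X0 : set X) : Prop :=
  forall a : 'rV[R]_d,
    {ae nu, forall x, X0 x -> dotp a (F x) = 0} -> a = 0.

End Families.

(* Main.v *)
Require Import Defs.
From mathcomp Require Import ring measurable_realfun.

(* Put k = e^(-lam phi(vt)).  Then p_vt = exp_q(theta.F - c) pointwise, with
   theta = k vt and c = (1 - k) / lam, so c normalizes theta.  Since exp_q is
   strictly increasing where it is positive and finite, theta has at most one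
   normalizing constant.  Hence theta determines c, then k, then vt. *)

Local Open Scope classical_set_scope.
Local Open Scope ring_scope.

(** The difference [g - f] is nonnegative with integral zero, so it vanishes a.e. Integrability
    makes both functions finite a.e., which is what lets the extended-real difference be
    cancelled. *)
Lemma ae_eq_le_integral {disp : measure_display} {X : measurableType disp}
    {R : realType} (mu : {measure set X -> \bar R}) {D : set X}
    {f g : X -> \bar R} :
  measurable D -> mu.-integrable D f -> mu.-integrable D g ->
  (forall x, D x -> (f x <= g x)%E) ->
  (\int[mu]_(x in D) f x = \int[mu]_(x in D) g x)%E ->
  ae_eq mu D f g.
Proof.
move=> mD intf intg fg eq_fg.
have finf := integrable_ae mD intf; have fing := integrable_ae mD intg.
have mh : measurable_fun D (fun x => g x - f x)%E.
  by apply: emeasurable_funB; [case/integrableP: intg | case/integrableP: intf].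
have : (\int[mu]_(x in D) `|g x - f x| = 0)%E.
  transitivity (\int[mu]_(x in D) (g x - f x))%E.
    apply: ae_eq_integral => //; first exact: measurableT_comp.
    apply: filterS2 finf fing => x hf hg Dx.
    by rewrite gee0_abs // sube_ge0 ?hg ?fg ?orbT.
  rewrite (integralB mD intg intf) eq_fg subee //; exact: integrable_fin_num.
move=> /(ae_eq_integral_abs _ mD mh) h0.
apply: filterS3 h0 finf fing => x hx hf hg Dx.
move: (hx Dx) (hf Dx) (hg Dx); case: (f x); case: (g x) => //= r s.
by move=> -[] /subr0_eq ->.
Qed.

Section QExponential.
Context {R : realType}.
Implicit Types (lam t k : R).

Lemma expq_ge0 (q t : R) : (0 <= expq q t)%E.
Proof. by rewrite /expq /epow; case: ifP => // _; rewrite lee_fin powR_ge0. Qed.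

(** The value [+oo] at base zero absorbs the positive factor; elsewhere this is multiplicativity of
    [powR]. *)
Lemma epowM (a k s : R) : 0 <= a -> 0 < k ->
  epow (k * a) s = (epow a s * (k `^ s)%:E)%E.
Proof.
move=> a0 k0; rewrite /epow mulf_eq0 gt_eqF //=.
case: ifP => _; first by rewrite gt0_mulye // lte_fin powR_gt0.
by rewrite powRM ?(ltW k0) // -EFinM mulrC.
Qed.

(* The arguments of the two q-exponentials are proportional:
   1 + lam (e^(-lam p) t - (1 - e^(-lam p)) / lam) = e^(-lam p) (1 + lam t). *)
Lemma expq_rescale (lam t p : R) : lam != 0 ->
  (expq (1 - lam) t * (expR (- p))%:E)%E =
  expq (1 - lam) (expR (- lam * p) * t - (1 - expR (- lam * p)) / lam).
Proof.
move=> lam0; rewrite /expq !subKr.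
set k := expR (- lam * p).
have -> : 1 + lam * (k * t - (1 - k) / lam) = k * (1 + lam * t) by field.
have k0 : 0 < k by exact: expR_gt0.
(* Reading [0] as [k * 0] pulls [k] out of the truncation; its power [1 / lam] is then
   [expR (- p)]. *)
rewrite -{2}(mulr0 k) -maxr_pMr ?(ltW k0) // epowM ?le_max ?lexx ?orbT // /k /powR gt_eqF ?expR_gt0 // expRK.
by congr (_ * (expR _)%:E)%E; field.
Qed.

(** Strictness can fail only through truncation of the base: for [lam > 0] this happens first at the
    smaller argument and gives [0]; for [lam < 0] the base decreases in [t], and it happens first at
    the larger argument and gives [+oo]. *)
Lemma expq_lt_or {lam t t' : R} : lam != 0 -> t < t' ->
  [\/ expq (1 - lam) t = 0, expq (1 - lam) t' = +oo%E
    | (expq (1 - lam) t < expq (1 - lam) t')%E].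
Proof.
rewrite /expq !subKr /epow => /lt_total/orP[lam0|lam0] tt'; rewrite invr_lt0.
- rewrite lam0 !andbT.
  have tt'2 : 1 + lam * t' < 1 + lam * t by rewrite ltrD2l ltr_nM2l.
  have [h|h] := leP (1 + lam * t') 0; first by rewrite eqxx; constructor 2.
  have h2 := lt_trans h tt'2.
  rewrite (max_l (ltW h2)) !gt_eqF //; constructor 3.
  (* Inverting turns the negative exponent into [- lam^-1 > 0], for which the power is increasing in
     its base. *)
  rewrite lte_fin -[lam^-1]opprK !(powRN _ (- lam^-1)) ltf_pV2 ?posrE ?powR_gt0 //.
  by apply: gt0_ltr_powR; rewrite ?nnegrE ?oppr_gt0 ?invr_lt0 ?ltW.
- rewrite (lt_gtF lam0) !andbF.
  have tt'2 : 1 + lam * t < 1 + lam * t' by rewrite ltrD2l ltr_pM2l.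
  have [h|h] := leP (1 + lam * t) 0.
    by constructor 1; rewrite powR0 // invr_eq0 gt_eqF.
  have h2 := lt_trans h tt'2.
  rewrite (max_l (ltW h2)); constructor 3; rewrite lte_fin.
  by apply: gt0_ltr_powR; rewrite ?nnegrE ?invr_gt0 ?ltW.
Qed.

Lemma expq_le {lam t t' : R} : lam != 0 -> t <= t' ->
  (expq (1 - lam) t <= expq (1 - lam) t')%E.
Proof.
move=> lam0; rewrite le_eqVlt => /predU1P[->//|/(expq_lt_or lam0)[->|->|/ltW//]].
- exact: expq_ge0.
- exact: leey.
Qed.

Lemma measurable_expq (q : R) : measurable_fun [set: R] (expq q).
Proof.
apply: (@measurableT_comp _ _ _ _ _ _ (fun a => epow a (1 - q)^-1)); last first.
  by apply: measurable_maxr => //; apply: measurable_funD => //; exact: measurable_funM.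
rewrite /epow; apply: measurable_fun_ifT => //.
  by apply: measurable_and => //; exact: measurable_fun_eqr.
apply/measurable_EFinP; exact: measurable_powR.
Qed.

End QExponential.

Section Families.
Context {R : realType} {disp : measure_display} {X : measurableType disp}
  {d : nat}.
Context {nu : {measure set X -> \bar R}} {F : X -> 'rV[R]_d} {lam : R}.
Hypothesis lam_neq0 : lam != 0.

Lemma dotpZl k (u v : 'rV[R]_d) : dotp (k *: u) v = k * dotp u v.
Proof. by rewrite /dotp mulr_sumr; apply: eq_bigr => i _; rewrite mxE mulrA. Qed.

Lemma measurable_expq_dotp (q c : R) (th : 'rV[R]_d) : measurable_vec F ->
  measurable_fun [set: X] (fun x => expq q (dotp th (F x) - c)).
Proof.
move=> mF; apply: measurableT_comp; first exact: measurable_expq.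
apply: measurable_funB => //; apply: measurable_sum => i.
exact: measurable_funM.
Qed.

(** If [c < c'], the two integrands are ordered pointwise and share the integral 1, so they agree
    a.e. *)
Lemma q_normalizer_inj {X0 : set X} {th : 'rV[R]_d} {c c' : R} :
  measurable_vec F -> measurable X0 ->
  q_normalizer nu F X0 (1 - lam) th c -> q_normalizer nu F X0 (1 - lam) th c' ->
  c = c'.
Proof.
move=> mF mX0.
wlog cc' : c c' / c < c' => [hw nc nc'|nc nc'].
  by case: (ltgtP c c') => // h; [exact: hw | apply/esym/hw].
set f := fun e x => expq (1 - lam) (dotp th (F x) - e).
have mf e : measurable_fun X0 (f e).
  exact/measurable_funTS/measurable_expq_dotp.
have intf e : q_normalizer nu F X0 (1 - lam) th e -> nu.-integrable X0 (f e).
  move=> ne; apply/integrableP; split=> //.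
  under eq_integral do rewrite gee0_abs ?expq_ge0 //.
  by rewrite ne ltry.
have aeff : ae_eq nu X0 (f c') (f c).
  apply: ae_eq_le_integral; rewrite ?nc ?nc' //; try exact: intf.
  by move=> x _; apply: expq_le => //; rewrite lerD2l lerN2 ltW.
(* Where the integrands agree, strict growth is impossible, and [+oo] is excluded a.e. by
   integrability; only the value [0] remains, contradicting the integral 1. *)
have f0 : ae_eq nu X0 (f c') (cst 0).
  apply: filterS2 aeff (integrable_ae mX0 (intf _ nc)) => x eqf finf X0x.
  have : dotp th (F x) - c' < dotp th (F x) - c by rewrite ltrD2l ltrN2.
  move=> /(expq_lt_or lam_neq0)[//|h|].
  - by have := finf X0x; rewrite /f h.
  - by rewrite -/(f c' x) -/(f c x) eqf // ltxx.
have := nc'; rewrite /q_normalizer /= (ae_eq_integral (cst 0) _ mX0 (mf c') _ f0) //.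
by rewrite integral0 => /esym/eqP; rewrite onee_eq0.
Qed.

Lemma lam_phi_fin {vt : 'rV[R]_d} : lam_exponential_family nu F lam ->
  lam_Omega nu F lam vt -> lam_phi nu F lam vt \is a fin_num.
Proof.
move=> [mF hF] Ovt; move: (Ovt); rewrite /lam_Omega /=.
case phi_eq : (lam_phi nu F lam vt) => [r| |] // _.
(* When phi = -oo the density takes only the values 0 and +oo, so it equals
   its double and cannot have integral 1. *)
have mD : measurable_fun [set: X] (lam_density nu F lam vt).
  apply: emeasurable_funM => //.
  have := measurable_expq_dotp (1 - lam) 0 vt mF.
  by under eq_fun do rewrite subr0.
have D0 x : (0 <= lam_density nu F lam vt x)%E.
  by rewrite mule_ge0 ?expq_ge0 // expeR_ge0.
have DD x : (lam_density nu F lam vt x + lam_density nu F lam vt x =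
    lam_density nu F lam vt x)%E.
  rewrite /lam_density phi_eq /=.
  have := expq_ge0 (1 - lam) (dotp vt (F x)).
  rewrite le_eqVlt => /predU1P[<-|h]; first by rewrite mul0e adde0.
  by rewrite gt0_muley.
have := ge0_integralD nu measurableT (fun x _ => D0 x) mD (fun x _ => D0 x) mD.
under eq_integral do rewrite DD.
rewrite hF // => /eqP; rewrite -EFinD eqe -subr_eq0 opprD addrA subrr sub0r.
by rewrite oppr_eq0 oner_eq0.
Qed.

Let scale vt := expR (- lam * fine (lam_phi nu F lam vt)).

(** An explicit constant stands in place of [q_phi], with which it can be identified only once
    normalizers are known to be unique. *)
Lemma lam_densityE (vt : 'rV[R]_d) (x : X) : lam_exponential_family nu F lam ->
  lam_Omega nu F lam vt ->
  lam_density nu F lam vt x =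
  expq (1 - lam) (dotp (lam_to_q nu F lam vt) (F x) - (1 - scale vt) / lam).
Proof.
move=> hF Ovt; rewrite /lam_density -(fineK (lam_phi_fin hF Ovt)) /=.
by rewrite expq_rescale // /lam_to_q dotpZl.
Qed.

Lemma measurable_lam_density (vt : 'rV[R]_d) :
  lam_exponential_family nu F lam -> lam_Omega nu F lam vt ->
  measurable_fun [set: X] (lam_density nu F lam vt).
Proof.
move=> hF Ovt; rewrite (funext (fun x => lam_densityE _ x hF Ovt)).
by apply: measurable_expq_dotp; case: hF.
Qed.

(** Measurability of [X0] is inherited from the density of any single member of the family, whose
    positivity set it is. *)
Lemma measurable_support {X0 : set X} {vt : 'rV[R]_d} :
  lam_exponential_family nu F lam -> support_condition nu F lam X0 ->
  lam_Omega nu F lam vt -> measurable X0.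
Proof.
move=> hF hX0 Ovt; rewrite -(hX0 _ Ovt) -[X in measurable X]setTI.
by apply: measurable_lte => //; exact: measurable_lam_density.
Qed.

Lemma q_normalizer_lam_to_q {X0 : set X} {vt : 'rV[R]_d} :
  lam_exponential_family nu F lam -> support_condition nu F lam X0 ->
  lam_Omega nu F lam vt ->
  q_normalizer nu F X0 (1 - lam) (lam_to_q nu F lam vt) ((1 - scale vt) / lam).
Proof.
move=> hF hX0 Ovt; rewrite /q_normalizer /=.
under eq_integral do rewrite -lam_densityE //.
rewrite -(hF.2 _ Ovt) integral_mkcond; apply: eq_integral => x _.
(* Off [X0] the density is zero, so restricting the integral to [X0] keeps the total mass 1. *)
rewrite patchE; case: ifPn => //; rewrite notin_setE -(hX0 _ Ovt) /= => /negP.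
rewrite -leNgt => D0; apply/eqP; rewrite eq_le D0 andbT.
by rewrite lam_densityE // expq_ge0.
Qed.

End Families.

Theorem proposition3p7 (R : realType) (disp : measure_display)
    (X : measurableType disp) (nu : {measure set X -> \bar R})
    (d : nat) (F : X -> 'rV[R]_d) (lam q : R) (X0 : set X)
    (lam_neq0 : lam != 0) (q_def : q = 1 - lam)
    (family : lam_exponential_family nu F lam)
    (support : support_condition nu F lam X0) :
  (forall vt : 'rV[R]_d, lam_Omega nu F lam vt ->
     q_Theta nu F X0 q (lam_to_q nu F lam vt) /\
     (forall x : X, X0 x ->
        lam_density nu F lam vt x
        = q_density nu F X0 q (lam_to_q nu F lam vt) x)) /\
  (ae_linearly_independent nu F X0 ->
     set_inj (lam_Omega nu F lam) (lam_to_q nu F lam)).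
Proof.
rewrite {q}q_def; split=> [vt Ovt|_ vt vt' /set_mem Ovt /set_mem Ovt' eq_th].
  have nth := q_normalizer_lam_to_q lam_neq0 family support Ovt.
  split; first by exists ((1 - expR (- lam * fine (lam_phi nu F lam vt))) / lam).
  move=> x _; rewrite lam_densityE // /q_density /q_phi.
  (* [q_phi] is some chosen normalizer [c], and uniqueness equates it with the explicit one; the
     default value is ruled out by [nth]. *)
  case: xgetP => [c _ nc|/(_ _ nth)//]; congr (expq _ (_ - _)).
  have mX0 := measurable_support lam_neq0 family support Ovt.
  exact: (q_normalizer_inj lam_neq0 family.1 mX0 nth nc).
(* Equal images have the same normalizing constant, which determines the scale
   factor. *)
have nth := q_normalizer_lam_to_q lam_neq0 family support Ovt.
have nth' := q_normalizer_lam_to_q lam_neq0 family support Ovt'.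
have mX0 := measurable_support lam_neq0 family support Ovt.
rewrite -eq_th in nth'.
have := q_normalizer_inj lam_neq0 family.1 mX0 nth nth'.
move=> /(mulIf (invr_neq0 lam_neq0)) /addrI /oppr_inj eq_scale.
have k_neq0 : expR (- lam * fine (lam_phi nu F lam vt)) != 0.
  by rewrite gt_eqF ?expR_gt0.
by apply: (scalerI k_neq0); rewrite [in RHS]eq_scale.
Qed.
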